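(* Let $p\ge1$ be an integer and let $F$ be a polyharmonic mapping in the unit disk $\mathbb{D}$ of the form $$F(z)=\sum_{n=1}^{p}|z|^{2(n-1)}\big(h_n(z)+\overline{g_n(z)}\big)=\sum_{n=1}^{p}|z|^{2(n-1)}\sum_{j=1}^{\infty}\big(a_{n,j}z^{j}+\overline{b_{n,j}}\,\overline{z}^{j}\big).$$ Suppose that there exists a constant $M>0$ such that $F(\mathbb{D})\subset\mathbb{D}_M$ and $$\sum_{n=1}^{p}\sum_{j=1}^{\infty}\big(|a_{n,j}|+|b_{n,j}|\big)\le M.$$ Then for all $z,w\in\mathbb{D}$, $$j_{\mathbb{D}_M}(F(z),F(w))\le j_{\mathbb{D}}(z,w).$$ This inequality is sharp (the Lipschitz constant $1$ on the right-hand side cannot be replaced by a smaller constant valid for all such $F$, $z$, $w$).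
   Context: $\mathbb{D}_r=\{z\in\mathbb{C}:|z|<r\}$ and $\mathbb{D}=\mathbb{D}_1$. A complex-valued mapping $F$ is polyharmonic ($p$-harmonic) in a domain if $\Delta^pF=0$ there, where $\Delta=4\,\partial^2/\partial z\partial\overline z$. In the displayed form, $h_n(z)=\sum_{j\ge1}a_{n,j}z^j$ and $g_n(z)=\sum_{j\ge1}b_{n,j}z^j$ are analytic in $\mathbb{D}$ with complex coefficients. For a proper subdomain $G\subset\mathbb{C}$ and $z,w\in G$, the distance ratio metric is $$j_G(z,w)=\log\left(1+\frac{|z-w|}{\min\{d(z,\partial G),d(w,\partial G)\}}\right),$$ where $d(z,\partial G)$ is the Euclidean distance from $z$ to $\partial G$. *)

(* Defs.v *)
(* Stdlib world: the concrete reals R, with Coquelicot and its complex numbers C. *)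
From Stdlib Require Export Reals.
From Coquelicot Require Export Coquelicot.

Open Scope R_scope.

Definition open_disk (r : R) : C -> Prop := fun z => Cmod z < r.

Definition unit_disk : C -> Prop := open_disk 1.

Definition boundary (G : C -> Prop) (z : C) : Prop :=
  forall eps : R, 0 < eps ->
    (exists w : C, Cmod (z - w) < eps /\ G w) /\
    (exists w : C, Cmod (z - w) < eps /\ ~ G w).

(* The infimum is a genuine real number whenever [A] is nonempty; the boundary
   of a nonempty proper subset of [C] is. *)
Definition distance_to (z : C) (A : C -> Prop) : R :=
  real (Glb_Rbar (fun d => exists w : C, A w /\ d = Cmod (z - w))).

Definition distance_ratio (G : C -> Prop) (z w : C) : R :=
  ln (1 + Cmod (z - w) / Rmin (distance_to z (boundary G)) (distance_to w (boundary G))).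

(* A map F = U + iV of z = x + iy has the partial derivatives
   F_x = U_x + i V_x and F_y = U_y + i V_y.  [Derive] is a total operator:
   the values are meaningful where [has_partials] holds. *)
Definition has_partials (F : C -> C) (z : C) : Prop :=
  (ex_derive (fun x : R => Re (F (x, Im z))) (Re z) /\
   ex_derive (fun x : R => Im (F (x, Im z))) (Re z)) /\
  (ex_derive (fun y : R => Re (F (Re z, y))) (Im z) /\
   ex_derive (fun y : R => Im (F (Re z, y))) (Im z)).

Definition partial_x (F : C -> C) (z : C) : C :=
  (Derive (fun x : R => Re (F (x, Im z))) (Re z),
   Derive (fun x : R => Im (F (x, Im z))) (Re z)).

Definition partial_y (F : C -> C) (z : C) : C :=
  (Derive (fun y : R => Re (F (Re z, y))) (Im z),
   Derive (fun y : R => Im (F (Re z, y))) (Im z)).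

Fixpoint continuously_differentiable (k : nat) (G : C -> Prop) (F : C -> C) : Prop :=
  match k with
  | O => forall z : C, G z -> continuous F z
  | S k' =>
      (forall z : C, G z -> has_partials F z) /\
      continuously_differentiable k' G (partial_x F) /\
      continuously_differentiable k' G (partial_y F)
  end.

Definition d_z (F : C -> C) (z : C) : C :=
  ((partial_x F z - Ci * partial_y F z) / 2)%C.

Definition d_zbar (F : C -> C) (z : C) : C :=
  ((partial_x F z + Ci * partial_y F z) / 2)%C.

Definition laplacian (F : C -> C) (z : C) : C := (4 * d_z (d_zbar F) z)%C.

(* [G] is meant to be open, so that all derivatives at points of [G] depend
   only on the restriction of [F] to [G]. *)
Definition polyharmonic (p : nat) (G : C -> Prop) (F : C -> C) : Prop :=
  continuously_differentiable (2 * p) G F /\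
  forall z : C, G z -> Nat.iter p laplacian F z = 0.

Definition analytic_on (G : C -> Prop) (h : C -> C) : Prop :=
  forall z : C, G z -> ex_derive (K := C_AbsRing) (V := C_NormedModule) h z.

(* h(z) = sum_{j >= 1} a_j z^j, summed over j - 1; the value [a 0] is unused. *)
Definition power_series_on (G : C -> Prop) (a : nat -> C) (h : C -> C) : Prop :=
  forall z : C, G z ->
    is_series (K := C_AbsRing) (V := C_NormedModule)
      (fun j : nat => (a (S j) * z ^ S j)%C) (h z).

(* Only the coefficients [a n j], [b n j] with 1 <= n <= p and 1 <= j are used. *)
Definition polyharmonic_form (p : nat) (a b : nat -> nat -> C) (F : C -> C) : Prop :=
  exists h g : nat -> C -> C,
    (forall n : nat, (1 <= n <= p)%nat ->
       analytic_on unit_disk (h n) /\ power_series_on unit_disk (a n) (h n) /\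
       analytic_on unit_disk (g n) /\ power_series_on unit_disk (b n) (g n)) /\
    (forall z : C, unit_disk z ->
       F z = sum_n_m (fun n : nat =>
               (RtoC (Cmod z ^ (2 * (n - 1))) * (h n z + Cconj (g n z)))%C) 1 p).

(* [Series] is total, so convergence of each inner series is stated separately. *)
Definition coefficient_sum_le (p : nat) (a b : nat -> nat -> C) (M : R) : Prop :=
  (forall n : nat, (1 <= n <= p)%nat ->
     ex_series (fun j : nat => Cmod (a n (S j)) + Cmod (b n (S j)))) /\
  sum_n_m (fun n : nat =>
    Series (fun j : nat => Cmod (a n (S j)) + Cmod (b n (S j)))) 1 p <= M.

Definition admissible (p : nat) (M : R) (F : C -> C) : Prop :=
  polyharmonic p unit_disk F /\
  (forall z : C, unit_disk z -> open_disk M (F z)) /\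
  exists a b : nat -> nat -> C,
    polyharmonic_form p a b F /\ coefficient_sum_le p a b M.

(* Main.v *)
Require Import Defs.
From Stdlib Require Import Reals Lra Lia FunctionalExtensionality.
From Coquelicot Require Import Coquelicot.
Open Scope R_scope.

(** The inequality says that [Fz = F z] and [Fw = F w] satisfy
    [(1 - r) |Fz - Fw| <= |z - w| (M - max(|Fz|, |Fw|))] with
    [r = max(|z|, |w|)], because the distance from a point [u] of the disk of
    radius [M] to its boundary is [M - |u|].  For [z <> w] put
    [k = (1 - r) / |z - w|]; the claim becomes
    [max(|Fz|, |Fw|) + k |Fz - Fw| <= M].

    The left-hand side is the value at [(Fz, Fw)] of the norm
    [N(u, v) = max(|u|, |v|) + k |u - v|] on pairs of complex numbers.  This
    norm ([pair_norm]) is submultiplicative for componentwise products, because of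
    [u u' - v v' = u (u' - v') + (u - v) v'], it is invariant under
    conjugation, it does not increase under taking moduli, and [N(1, 1) = 1].
    The choice of [k] makes [N(z, w) = 1].  Hence every monomial
    [|z|^(2(n-1)) z^j], and every conjugate of one, has norm at most [1] on the
    pair of points, and the triangle inequality for the expansion of [F] bounds
    [N(Fz, Fw)] by the sum of the moduli of the coefficients, which is at most
    [M] ([pair_norm_mult], [pair_norm_series], [pair_norm_polyharmonic_form]).

    The constant is sharp because [F(z) = M z] is admissible and turns the
    inequality into an equality for all [z] and [w] ([distance_ratio_dilation]);
    at [0] and [1/2] both sides are [ln 2 > 0]. *)

(** * A Banach algebra norm on pairs of points *)

Definition pair_norm (k : R) (u v : C) : R :=
  Rmax (Cmod u) (Cmod v) + k * Cmod (u - v).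

(** The maximum is awkward in limits and in arithmetic; a bound on the norm
    splits into two bounds without it. *)
Lemma pair_norm_le_iff (k : R) (u v : C) (c : R) :
  pair_norm k u v <= c <->
  Cmod u + k * Cmod (u - v) <= c /\ Cmod v + k * Cmod (u - v) <= c.
Proof.
  unfold pair_norm.
  split; [intros H; split |].
  - pose proof (Rmax_l (Cmod u) (Cmod v)); lra.
  - pose proof (Rmax_r (Cmod u) (Cmod v)); lra.
  - intros [H1 H2]; unfold Rmax; destruct (Rle_dec _ _); lra.
Qed.

Lemma pair_norm_ge0 (k : R) (u v : C) : 0 <= k -> 0 <= pair_norm k u v.
Proof.
  intros Hk; unfold pair_norm.
  pose proof (Rmax_l (Cmod u) (Cmod v)); pose proof (Cmod_ge_0 u).
  pose proof (Rmult_le_pos _ _ Hk (Cmod_ge_0 (u - v))); lra.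
Qed.

Lemma pair_norm_diag (k : R) (u : C) : pair_norm k u u = Cmod u.
Proof.
  unfold pair_norm, Cminus.
  rewrite Cplus_opp_r, Cmod_0, Rmax_left; lra.
Qed.

Lemma pair_norm_plus (k : R) (u v u' v' : C) :
  0 <= k ->
  pair_norm k (u + u') (v + v') <= pair_norm k u v + pair_norm k u' v'.
Proof.
  intros Hk; apply pair_norm_le_iff.
  destruct (proj1 (pair_norm_le_iff k u v _) (Rle_refl _)) as [H1 H2].
  destruct (proj1 (pair_norm_le_iff k u' v' _) (Rle_refl _)) as [H3 H4].
  pose proof (Cmod_triangle u u') as Hu; pose proof (Cmod_triangle v v') as Hv.
  pose proof (Cmod_triangle (u - v) (u' - v')) as Hd.
  replace (u - v + (u' - v'))%C with (u + u' - (v + v'))%C in Hd by ring.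
  apply (Rmult_le_compat_l k) in Hd; [| exact Hk].
  rewrite Rmult_plus_distr_l in Hd; split; lra.
Qed.

(** With [m = max(|u|, |v|)] and [d = |u - v|], and likewise [m'], [d'], the
    splitting [u u' - v v' = u (u' - v') + (u - v) v'] bounds the norm of the
    product by [m m' + k (m d' + d m')], which is [(m + k d) (m' + k d')] up to
    the nonnegative term [k^2 d d']. *)
Lemma pair_norm_mult (k : R) (u v u' v' : C) :
  0 <= k ->
  pair_norm k (u * u') (v * v') <= pair_norm k u v * pair_norm k u' v'.
Proof.
  intros Hk.
  assert (Hd : Cmod (u * u' - v * v') <=
               Cmod u * Cmod (u' - v') + Cmod (u - v) * Cmod v').
  { replace (u * u' - v * v')%C with (u * (u' - v') + (u - v) * v')%C by ring.
    eapply Rle_trans; [apply Cmod_triangle |].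
    rewrite !Cmod_mult; lra. }
  apply pair_norm_le_iff; rewrite !Cmod_mult; unfold pair_norm.
  pose proof (Rmax_l (Cmod u) (Cmod v)) as Hu.
  pose proof (Rmax_r (Cmod u) (Cmod v)) as Hv.
  pose proof (Rmax_l (Cmod u') (Cmod v')) as Hu'.
  pose proof (Rmax_r (Cmod u') (Cmod v')) as Hv'.
  pose proof (Cmod_ge_0 u); pose proof (Cmod_ge_0 v).
  pose proof (Cmod_ge_0 u'); pose proof (Cmod_ge_0 v').
  pose proof (Cmod_ge_0 (u - v)) as Hd1; pose proof (Cmod_ge_0 (u' - v')) as Hd2.
  set (m := Rmax (Cmod u) (Cmod v)) in *.
  set (m' := Rmax (Cmod u') (Cmod v')) in *.
  set (d := Cmod (u - v)) in *; set (d' := Cmod (u' - v')) in *.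
  assert (Hkd : k * Cmod (u * u' - v * v') <= k * (m * d' + d * m')).
  { apply Rmult_le_compat_l; [exact Hk |].
    eapply Rle_trans; [exact Hd |].
    apply Rplus_le_compat;
      [apply Rmult_le_compat_r | apply Rmult_le_compat_l]; assumption. }
  assert (Huu : Cmod u * Cmod u' <= m * m') by (apply Rmult_le_compat; assumption).
  assert (Hvv : Cmod v * Cmod v' <= m * m') by (apply Rmult_le_compat; assumption).
  pose proof (Rmult_le_pos _ _ (Rmult_le_pos _ _ Hk Hd1)
                               (Rmult_le_pos _ _ Hk Hd2)).
  split; lra.
Qed.

Lemma pair_norm_conj (k : R) (u v : C) :
  pair_norm k (Cconj u) (Cconj v) = pair_norm k u v.
Proof. unfold pair_norm; rewrite <- Cminus_conj, !Cmod_conj; reflexivity. Qed.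

Lemma Rabs_Cmod_minus_le (u v : C) : Rabs (Cmod u - Cmod v) <= Cmod (u - v).
Proof.
  pose proof (Cmod_triangle (u - v) v) as H1.
  pose proof (Cmod_triangle (v - u) u) as H2.
  replace (u - v + v)%C with u in H1 by ring.
  replace (v - u + u)%C with v in H2 by ring.
  rewrite <- (Cmod_opp (v - u)) in H2.
  replace (- (v - u))%C with (u - v)%C in H2 by ring.
  apply Rabs_le; lra.
Qed.

Lemma pair_norm_Cmod (k : R) (u v : C) :
  0 <= k -> pair_norm k (RtoC (Cmod u)) (RtoC (Cmod v)) <= pair_norm k u v.
Proof.
  intros Hk; unfold pair_norm.
  rewrite <- RtoC_minus, !Cmod_R.
  rewrite !(Rabs_pos_eq (Cmod _)) by apply Cmod_ge_0.
  apply Rplus_le_compat_l, Rmult_le_compat_l; [exact Hk |].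
  apply Rabs_Cmod_minus_le.
Qed.

Lemma pair_norm_mult_le1 (k : R) (u v u' v' : C) (c : R) :
  0 <= k -> pair_norm k u v <= 1 -> pair_norm k u' v' <= c ->
  pair_norm k (u * u') (v * v') <= c.
Proof.
  intros Hk H1 H2.
  eapply Rle_trans; [apply pair_norm_mult; exact Hk |].
  rewrite <- (Rmult_1_l c).
  apply Rmult_le_compat; auto using pair_norm_ge0.
Qed.

Lemma pair_norm_pow_le1 (k : R) (u v : C) (n : nat) :
  0 <= k -> pair_norm k u v <= 1 -> pair_norm k (u ^ n) (v ^ n) <= 1.
Proof.
  intros Hk H; induction n as [| n IH]; simpl.
  - rewrite pair_norm_diag, Cmod_1; apply Rle_refl.
  - apply pair_norm_mult_le1; assumption.
Qed.

Lemma pair_norm_sum_n_m (k : R) (u v : nat -> C) (c : nat -> R) (n m : nat) :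
  0 <= k ->
  (forall i, (n <= i <= m)%nat -> pair_norm k (u i) (v i) <= c i) ->
  pair_norm k (sum_n_m u n m) (sum_n_m v n m) <= sum_n_m c n m.
Proof.
  intros Hk; revert u v c m.
  assert (Hstop : forall u v c m, (m < n)%nat ->
    pair_norm k (sum_n_m u n m) (sum_n_m v n m) <= sum_n_m c n m).
  { intros u v c m Hm; rewrite !sum_n_m_zero by exact Hm.
    rewrite pair_norm_diag; unfold zero; simpl.
    rewrite Cmod_0; apply Rle_refl. }
  intros u v c m; induction m as [| m IH]; intros H.
  - destruct n as [| n].
    + rewrite !sum_n_n; apply H; lia.
    + apply Hstop; lia.
  - destruct (Compare_dec.le_lt_dec n (S m)) as [Hnm | Hnm]; [| now apply Hstop].
    rewrite !sum_n_Sm by exact Hnm.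
    eapply Rle_trans; [apply (pair_norm_plus k); exact Hk |].
    apply Rplus_le_compat; [apply IH; intros; apply H; lia | apply H; lia].
Qed.

Lemma is_series_Cmod_lim (u : nat -> C) (U : C) :
  is_series (K := C_AbsRing) (V := C_NormedModule) u U ->
  is_lim_seq (fun n => Cmod (sum_n u n)) (Cmod U).
Proof.
  intros H.
  exact (filterlim_comp _ _ _ _ _ _ _ _ H
           (filterlim_norm (K := C_AbsRing) (V := C_NormedModule) U)).
Qed.

(** The norm is continuous, so the triangle inequality for the partial sums
    survives in the limit. *)
Lemma pair_norm_series (k : R) (u v : nat -> C) (U V : C) (c : nat -> R) :
  0 <= k ->
  is_series (K := C_AbsRing) (V := C_NormedModule) u U ->
  is_series (K := C_AbsRing) (V := C_NormedModule) v V ->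
  ex_series c ->
  (forall n, pair_norm k (u n) (v n) <= c n) ->
  pair_norm k U V <= Series c.
Proof.
  intros Hk HU HV Hc Huv.
  assert (Hpart : forall n,
    pair_norm k (sum_n u n) (sum_n v n) <= sum_n c n).
  { intros n; apply pair_norm_sum_n_m; auto. }
  assert (Hd : is_lim_seq (fun n => Cmod (sum_n u n - sum_n v n)) (Cmod (U - V))).
  { apply is_lim_seq_ext with
      (fun n => Cmod (sum_n (fun i => minus (u i) (v i) : C_NormedModule) n)).
    - intros n; f_equal; induction n as [| n IH].
      + rewrite !sum_O; reflexivity.
      + rewrite !sum_Sn, IH; unfold plus, minus, opp; simpl.
        unfold plus; simpl; ring.
    - apply is_series_Cmod_lim; exact (is_series_minus _ _ _ _ HU HV). }
  assert (HC : is_lim_seq (sum_n c) (Series c))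
    by exact (Series_correct c Hc).
  apply pair_norm_le_iff; split.
  - refine (is_lim_seq_le
      (fun n => Cmod (sum_n u n) + k * Cmod (sum_n u n - sum_n v n)) (sum_n c)
      (Finite _) (Finite _) _ _ HC).
    + intros n; apply (pair_norm_le_iff k (sum_n u n)), Hpart.
    + apply is_lim_seq_plus'; [now apply is_series_Cmod_lim |].
      exact (is_lim_seq_scal_l _ k _ Hd).
  - refine (is_lim_seq_le
      (fun n => Cmod (sum_n v n) + k * Cmod (sum_n u n - sum_n v n)) (sum_n c)
      (Finite _) (Finite _) _ _ HC).
    + intros n; apply (pair_norm_le_iff k (sum_n u n)), Hpart.
    + apply is_lim_seq_plus'; [now apply is_series_Cmod_lim |].
      exact (is_lim_seq_scal_l _ k _ Hd).
Qed.

(** * Maps whose coefficients have a bounded sum *)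

Lemma pair_norm_power_series (k : R) (a : nat -> C) (h : C -> C) (z w : C) :
  0 <= k -> pair_norm k z w <= 1 -> unit_disk z -> unit_disk w ->
  power_series_on unit_disk a h ->
  ex_series (fun j => Cmod (a (S j))) ->
  pair_norm k (h z) (h w) <= Series (fun j => Cmod (a (S j))).
Proof.
  intros Hk H1 Hz Hw Hh Ha.
  apply (pair_norm_series k _ _ _ _ _ Hk (Hh z Hz) (Hh w Hw) Ha).
  intros j; rewrite (Cmult_comm _ (z ^ S j)), (Cmult_comm _ (w ^ S j)).
  apply pair_norm_mult_le1; [exact Hk | now apply pair_norm_pow_le1 |].
  rewrite pair_norm_diag; apply Rle_refl.
Qed.

Lemma pair_norm_polyharmonic_form (k : R) (p : nat) (a b : nat -> nat -> C)
    (F : C -> C) (M : R) (z w : C) :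
  0 <= k -> pair_norm k z w <= 1 -> unit_disk z -> unit_disk w ->
  polyharmonic_form p a b F -> coefficient_sum_le p a b M ->
  pair_norm k (F z) (F w) <= M.
Proof.
  intros Hk H1 Hz Hw [h [g [Hhg HF]]] [Hex HM].
  rewrite (HF z Hz), (HF w Hw).
  eapply Rle_trans; [| exact HM].
  apply pair_norm_sum_n_m; [exact Hk |]; intros n Hn.
  destruct (Hhg n Hn) as [_ [Hh [_ Hg]]].
  specialize (Hex n Hn).
  assert (Ha : ex_series (fun j => Cmod (a n (S j)))).
  { apply (ex_series_le (K := R_AbsRing) (V := R_CompleteNormedModule)
             _ (fun j => Cmod (a n (S j)) + Cmod (b n (S j)))); [| exact Hex].
    intros j; unfold norm; simpl; unfold abs; simpl.
    rewrite Rabs_pos_eq by apply Cmod_ge_0.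
    pose proof (Cmod_ge_0 (b n (S j))); lra. }
  assert (Hb : ex_series (fun j => Cmod (b n (S j)))).
  { apply (ex_series_le (K := R_AbsRing) (V := R_CompleteNormedModule)
             _ (fun j => Cmod (a n (S j)) + Cmod (b n (S j)))); [| exact Hex].
    intros j; unfold norm; simpl; unfold abs; simpl.
    rewrite Rabs_pos_eq by apply Cmod_ge_0.
    pose proof (Cmod_ge_0 (a n (S j))); lra. }
  rewrite Series_plus by assumption.
  apply pair_norm_mult_le1; [exact Hk | |].
  - rewrite !RtoC_pow; apply pair_norm_pow_le1; [exact Hk |].
    eapply Rle_trans; [apply pair_norm_Cmod; exact Hk | exact H1].
  - eapply Rle_trans; [apply pair_norm_plus; exact Hk |].
    rewrite pair_norm_conj.
    apply Rplus_le_compat; now apply pair_norm_power_series.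
Qed.

(** * The distance ratio metric of a disk *)

Lemma boundary_open_disk_Cmod (M : R) (w : C) :
  boundary (open_disk M) w -> M <= Cmod w.
Proof.
  intros Hw; apply Rnot_lt_le; intros Hlt.
  destruct (Hw (M - Cmod w)) as [_ [v [Hv1 Hv2]]]; [lra |].
  apply Hv2; unfold open_disk.
  pose proof (Rabs_Cmod_minus_le w v) as H; apply Rabs_le_between in H; lra.
Qed.

(** A point [w] with [|w| = M] is the limit of the points [(1 - t) w] of the
    disk, and does not belong to the disk itself. *)
Lemma Cmod_boundary_open_disk (M : R) (w : C) :
  0 < M -> Cmod w = M -> boundary (open_disk M) w.
Proof.
  intros HM Hw eps Heps; split.
  - set (t := Rmin 1 (eps / (2 * M))).
    assert (Ht0 : 0 < t).
    { apply Rmin_glb_lt; [lra |]; apply Rdiv_lt_0_compat; lra. }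
    assert (Ht1 : t <= 1) by apply Rmin_l.
    assert (Ht2 : t * M <= eps / 2).
    { replace (eps / 2) with (eps / (2 * M) * M) by (field; lra).
      apply Rmult_le_compat_r; [lra | apply Rmin_r]. }
    exists (RtoC (1 - t) * w)%C; unfold open_disk; split.
    + replace (w - RtoC (1 - t) * w)%C with (RtoC t * w)%C
        by (rewrite RtoC_minus; ring).
      rewrite Cmod_mult, Cmod_R, Rabs_pos_eq, Hw; lra.
    + rewrite Cmod_mult, Cmod_R, Rabs_pos_eq, Hw by lra.
      pose proof (Rmult_lt_0_compat _ _ Ht0 HM); lra.
  - exists w; split.
    + unfold Cminus; rewrite Cplus_opp_r, Cmod_0; exact Heps.
    + unfold open_disk; lra.
Qed.

Lemma exists_radial_point (M : R) (z : C) :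
  0 < M -> Cmod z < M ->
  exists w : C, Cmod w = M /\ Cmod (z - w) = M - Cmod z.
Proof.
  intros HM Hz.
  destruct (Req_dec (Cmod z) 0) as [H0 | H0].
  - exists (RtoC M); apply Cmod_eq_0 in H0; subst z.
    rewrite <- RtoC_minus, !Cmod_R, Rabs_R0, Rminus_0_l, Rabs_Ropp.
    rewrite Rabs_pos_eq; lra.
  - pose proof (Cmod_ge_0 z) as Hpos.
    exists (RtoC (M / Cmod z) * z)%C; split.
    + rewrite Cmod_mult, Cmod_R, Rabs_pos_eq; [field; exact H0 |].
      apply Rlt_le, Rdiv_lt_0_compat; lra.
    + replace (z - RtoC (M / Cmod z) * z)%C with (RtoC (1 - M / Cmod z) * z)%C
        by (rewrite RtoC_minus; ring).
      rewrite Cmod_mult, Cmod_R, Rabs_left1; [field; exact H0 |].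
      assert (M / Cmod z * Cmod z = M) by (field; exact H0).
      assert (1 <= M / Cmod z); [| lra].
      apply (Rmult_le_reg_r (Cmod z)); lra.
Qed.

Lemma distance_to_boundary_open_disk (M : R) (z : C) :
  0 < M -> open_disk M z ->
  distance_to z (boundary (open_disk M)) = M - Cmod z.
Proof.
  intros HM Hz; unfold distance_to.
  rewrite (is_glb_Rbar_unique _ (Finite (M - Cmod z))); [reflexivity |].
  split.
  - intros d [w [Hw Hd]]; subst d; simpl.
    apply boundary_open_disk_Cmod in Hw.
    pose proof (Rabs_Cmod_minus_le z w) as H; apply Rabs_le_between in H; lra.
  - intros b Hb.
    destruct (exists_radial_point M z HM Hz) as [w [Hw1 Hw2]].
    apply Hb; exists w; split; [now apply Cmod_boundary_open_disk | lra].
Qed.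

Lemma distance_ratio_open_disk (M : R) (z w : C) :
  0 < M -> open_disk M z -> open_disk M w ->
  distance_ratio (open_disk M) z w =
  ln (1 + Cmod (z - w) / (M - Rmax (Cmod z) (Cmod w))).
Proof.
  intros HM Hz Hw; unfold distance_ratio.
  rewrite !distance_to_boundary_open_disk by assumption.
  do 3 f_equal; unfold Rmin, Rmax.
  destruct (Rle_dec (M - Cmod z) (M - Cmod w)), (Rle_dec (Cmod z) (Cmod w)); lra.
Qed.

(** With [k = (1 - max(|z|, |w|)) / |z - w|] the pair [(z, w)] has norm exactly
    [1], so that the bound [M] on the norm of [(F z, F w)], once rearranged,
    compares the arguments of the two logarithms. *)
Lemma admissible_distance_ratio_le (p : nat) (M : R) (F : C -> C) (z w : C) :
  0 < M -> admissible p M F -> unit_disk z -> unit_disk w ->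
  distance_ratio (open_disk M) (F z) (F w) <= distance_ratio unit_disk z w.
Proof.
  intros HM [_ [HFM [a [b [Hform Hcoef]]]]] Hz Hw.
  pose proof (HFM z Hz) as HFz; pose proof (HFM w Hw) as HFw.
  unfold unit_disk at 1; rewrite !distance_ratio_open_disk; try assumption; [| lra].
  assert (Hr : 0 < 1 - Rmax (Cmod z) (Cmod w))
    by (pose proof (Rmax_lub_lt _ _ _ Hz Hw); lra).
  assert (HR : 0 < M - Rmax (Cmod (F z)) (Cmod (F w)))
    by (pose proof (Rmax_lub_lt _ _ _ HFz HFw); lra).
  assert (Hln : Cmod (F z - F w) / (M - Rmax (Cmod (F z)) (Cmod (F w))) <=
                Cmod (z - w) / (1 - Rmax (Cmod z) (Cmod w))).
  { destruct (Req_dec (Cmod (z - w)) 0) as [H0 | H0].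
    - assert (Hzw : z = w).
      { apply Cmod_eq_0 in H0; replace z with (z - w + w)%C by ring.
        rewrite H0; ring. }
      rewrite Hzw; unfold Cminus; rewrite !Cplus_opp_r, Cmod_0.
      unfold Rdiv; rewrite !Rmult_0_l; apply Rle_refl.
    - pose proof (Cmod_ge_0 (z - w)) as Hd.
      set (k := (1 - Rmax (Cmod z) (Cmod w)) / Cmod (z - w)).
      assert (Hk : 0 < k) by (apply Rdiv_lt_0_compat; lra).
      assert (HN : pair_norm k z w <= 1).
      { unfold pair_norm, k; apply Req_le; field; exact H0. }
      pose proof (pair_norm_polyharmonic_form k p a b F M z w
                    (Rlt_le _ _ Hk) HN Hz Hw Hform Hcoef) as H.
      unfold pair_norm in H.
      replace (Cmod (z - w) / (1 - Rmax (Cmod z) (Cmod w))) with (/ k)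
        by (unfold k; field; lra).
      apply (Rmult_le_reg_l k); [exact Hk |].
      rewrite Rinv_r by lra.
      apply (Rmult_le_reg_r (M - Rmax (Cmod (F z)) (Cmod (F w)))); [exact HR |].
      replace (k * (Cmod (F z - F w) / (M - Rmax (Cmod (F z)) (Cmod (F w)))) *
               (M - Rmax (Cmod (F z)) (Cmod (F w))))
        with (k * Cmod (F z - F w)) by (field; lra).
      lra. }
  apply ln_le; [| lra].
  pose proof (Rmult_le_pos _ _ (Cmod_ge_0 (F z - F w))
                (Rlt_le _ _ (Rinv_0_lt_compat _ HR))) as H.
  unfold Rdiv; lra.
Qed.

(** * The dilation is extremal *)

Lemma partial_x_const (c : C) : partial_x (fun _ => c) = (fun _ => RtoC 0).
Proof.
  apply functional_extensionality; intros z; unfold partial_x.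
  rewrite !Derive_const; reflexivity.
Qed.

Lemma partial_y_const (c : C) : partial_y (fun _ => c) = (fun _ => RtoC 0).
Proof.
  apply functional_extensionality; intros z; unfold partial_y.
  rewrite !Derive_const; reflexivity.
Qed.

Lemma continuously_differentiable_const (k : nat) (G : C -> Prop) (c : C) :
  continuously_differentiable k G (fun _ => c).
Proof.
  revert c; induction k as [| k IH]; intros c; simpl.
  - intros z _; apply continuous_const.
  - rewrite partial_x_const, partial_y_const.
    split; [| split; apply IH].
    intros z _; repeat split; apply ex_derive_const.
Qed.

Lemma has_partials_dilation (M : R) (z : C) :
  has_partials (fun z => (RtoC M * z)%C) z.
Proof. unfold has_partials; simpl; repeat split; auto_derive; exact I. Qed.

Lemma partial_x_dilation (M : R) :
  partial_x (fun z => (RtoC M * z)%C) = (fun _ => RtoC M).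
Proof.
  apply functional_extensionality; intros z; unfold partial_x, RtoC; f_equal;
    apply is_derive_unique; simpl; auto_derive; try exact I; ring.
Qed.

Lemma partial_y_dilation (M : R) :
  partial_y (fun z => (RtoC M * z)%C) = (fun _ => (Ci * RtoC M)%C).
Proof.
  apply functional_extensionality; intros z.
  apply injective_projections; simpl;
    apply is_derive_unique; simpl; auto_derive; try exact I; ring.
Qed.

Lemma laplacian_of_d_zbar_eq0 (F : C -> C) :
  d_zbar F = (fun _ => RtoC 0) -> laplacian F = (fun _ => RtoC 0).
Proof.
  intros H; apply functional_extensionality; intros z; unfold laplacian.
  rewrite H; unfold d_z; rewrite partial_x_const, partial_y_const.
  field; apply RtoC_inj_neq; lra.
Qed.

Lemma laplacian_zero : laplacian (fun _ => RtoC 0) = (fun _ => RtoC 0).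
Proof.
  apply laplacian_of_d_zbar_eq0, functional_extensionality; intros z.
  unfold d_zbar; rewrite partial_x_const, partial_y_const.
  field; apply RtoC_inj_neq; lra.
Qed.

Lemma laplacian_dilation (M : R) :
  laplacian (fun z => (RtoC M * z)%C) = (fun _ => RtoC 0).
Proof.
  apply laplacian_of_d_zbar_eq0, functional_extensionality; intros z.
  unfold d_zbar; rewrite partial_x_dilation, partial_y_dilation.
  apply injective_projections; simpl; field.
Qed.

Lemma polyharmonic_dilation (p : nat) (G : C -> Prop) (M : R) :
  (1 <= p)%nat -> polyharmonic p G (fun z => (RtoC M * z)%C).
Proof.
  intros Hp; destruct p as [| p]; [lia |]; split.
  - replace (2 * S p)%nat with (S (S (2 * p))) by lia.
    split; [intros z _; apply has_partials_dilation |].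
    rewrite partial_x_dilation, partial_y_dilation.
    split; apply continuously_differentiable_const.
  - intros z _; rewrite Nat.iter_succ_r, laplacian_dilation.
    assert (H : Nat.iter p laplacian (fun _ => RtoC 0) = (fun _ => RtoC 0)).
    { induction p as [| p IH]; [reflexivity |].
      simpl; rewrite IH by lia; exact laplacian_zero. }
    rewrite H; reflexivity.
Qed.

Lemma is_series_single {K : AbsRing} {V : NormedModule K} (u : nat -> V) :
  (forall j, u (S j) = zero) -> is_series u (u O).
Proof.
  intros H; apply filterlim_ext with (fun _ => u O); [| apply filterlim_const].
  intros n; induction n as [| n IH].
  - rewrite sum_O; reflexivity.
  - rewrite sum_Sn, <- IH, H, plus_zero_r; reflexivity.
Qed.

Definition linear_coefficient (c : C) (j : nat) : C :=
  match j with 1%nat => c | _ => RtoC 0 end.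

Lemma power_series_on_linear (G : C -> Prop) (c : C) :
  power_series_on G (linear_coefficient c) (fun z => (c * z)%C).
Proof.
  intros z _.
  replace (c * z)%C with (linear_coefficient c 1 * z ^ 1)%C by (simpl; ring).
  apply (is_series_single (K := C_AbsRing) (V := C_NormedModule)
           (fun j => (linear_coefficient c (S j) * z ^ S j)%C)).
  intros j; apply Cmult_0_l.
Qed.

Lemma analytic_on_linear (G : C -> Prop) (c : C) :
  analytic_on G (fun z => (c * z)%C).
Proof.
  intros z _.
  apply (ex_derive_ext (K := C_AbsRing) (V := C_NormedModule)
    (fun t : C => scal (K := C_AbsRing) (V := C_NormedModule) t c)).
  - intros t; apply Cmult_comm.
  - apply (ex_derive_scal_l (K := C_AbsRing) (V := C_NormedModule) (fun t => t)).
    apply ex_derive_id.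
Qed.

Lemma is_series_Cmod_linear_coefficient (c : C) :
  is_series (fun j => Cmod (linear_coefficient c (S j)) +
                      Cmod (linear_coefficient 0 (S j))) (Cmod c).
Proof.
  replace (Cmod c) with
    (Cmod (linear_coefficient c 1) + Cmod (linear_coefficient 0 1))
    by (simpl; rewrite Cmod_0; ring).
  apply (is_series_single (K := R_AbsRing) (V := R_NormedModule)
    (fun j => Cmod (linear_coefficient c (S j)) +
              Cmod (linear_coefficient 0 (S j)))).
  intros j; simpl; rewrite Cmod_0; apply Rplus_0_l.
Qed.

Lemma sum_n_m_single {G : AbelianMonoid} (u : nat -> G) (n m : nat) :
  (n <= m)%nat -> (forall i, (n < i)%nat -> u i = zero) -> sum_n_m u n m = u n.
Proof.
  intros Hnm H; rewrite sum_Sn_m by exact Hnm.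
  rewrite (sum_n_m_ext_loc _ (fun _ => zero)) by (intros; apply H; lia).
  rewrite sum_n_m_const_zero; apply plus_zero_r.
Qed.

Lemma admissible_dilation (p : nat) (M : R) :
  (1 <= p)%nat -> 0 < M -> admissible p M (fun z => (RtoC M * z)%C).
Proof.
  intros Hp HM; split; [now apply polyharmonic_dilation | split].
  - intros z Hz; unfold unit_disk, open_disk in *.
    rewrite Cmod_mult, Cmod_R, Rabs_pos_eq by lra.
    rewrite <- (Rmult_1_r M) at 2; now apply Rmult_lt_compat_l.
  - set (lead := fun n : nat => if Nat.eqb n 1 then RtoC M else RtoC 0).
    exists (fun n => linear_coefficient (lead n)), (fun _ => linear_coefficient 0).
    split; [exists (fun n z => (lead n * z)%C), (fun _ z => (0 * z)%C); split |
            split].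
    + intros n _; repeat split;
        auto using analytic_on_linear, power_series_on_linear.
    + intros z _; symmetry.
      rewrite sum_n_m_single; [| exact Hp |].
      * simpl; rewrite Cmult_0_l.
        apply injective_projections; simpl; ring.
      * intros n Hn; unfold lead.
        rewrite (proj2 (Nat.eqb_neq n 1)) by lia.
        apply injective_projections; simpl; ring.
    + intros n _; eexists; apply is_series_Cmod_linear_coefficient.
    + rewrite (sum_n_m_ext _ (fun n => Cmod (lead n)))
        by (intros n; apply is_series_unique, is_series_Cmod_linear_coefficient).
      rewrite sum_n_m_single; [| exact Hp |].
      * unfold lead; simpl; rewrite Cmod_R, Rabs_pos_eq; lra.
      * intros n Hn; unfold lead.
        rewrite (proj2 (Nat.eqb_neq n 1)) by lia.
        apply Cmod_0.
Qed.

Lemma distance_ratio_dilation (M : R) (z w : C) :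
  0 < M -> unit_disk z -> unit_disk w ->
  distance_ratio (open_disk M) (RtoC M * z) (RtoC M * w) =
  distance_ratio unit_disk z w.
Proof.
  intros HM Hz Hw.
  assert (Hdil : forall u, Cmod (RtoC M * u) = M * Cmod u).
  { intros u; rewrite Cmod_mult, Cmod_R, Rabs_pos_eq; lra. }
  assert (Hdisk : forall u, unit_disk u -> open_disk M (RtoC M * u)).
  { intros u Hu; unfold unit_disk, open_disk in *; rewrite Hdil.
    rewrite <- (Rmult_1_r M) at 2; now apply Rmult_lt_compat_l. }
  unfold unit_disk at 1; rewrite !distance_ratio_open_disk; auto; [| lra].
  pose proof (Rmax_lub_lt _ _ _ Hz Hw).
  replace (RtoC M * z - RtoC M * w)%C with (RtoC M * (z - w))%C by ring.
  rewrite !Hdil, RmaxRmult by lra.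
  rewrite <- (Rmult_1_r M) at 2; rewrite <- Rmult_minus_distr_l.
  do 2 f_equal; field; lra.
Qed.

Theorem theorem7 :
  forall (p : nat) (M : R), (1 <= p)%nat -> 0 < M ->
    (forall F : C -> C, admissible p M F ->
       forall z w : C, unit_disk z -> unit_disk w ->
         distance_ratio (open_disk M) (F z) (F w) <= distance_ratio unit_disk z w) /\
    (forall c : R,
       (forall F : C -> C, admissible p M F ->
          forall z w : C, unit_disk z -> unit_disk w ->
            distance_ratio (open_disk M) (F z) (F w) <= c * distance_ratio unit_disk z w) ->
       1 <= c).
Proof.
  intros p M Hp HM; split.
  - intros F HF z w; now apply (admissible_distance_ratio_le p).
  - intros c Hc.
    assert (H0 : unit_disk 0) by (unfold unit_disk, open_disk; rewrite Cmod_0; lra).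
    assert (H2 : Cmod (RtoC (1 / 2)) = 1 / 2) by (rewrite Cmod_R; apply Rabs_pos_eq; lra).
    assert (H1 : unit_disk (RtoC (1 / 2)))
      by (unfold unit_disk, open_disk; rewrite H2; lra).
    specialize (Hc _ (admissible_dilation p M Hp HM) _ _ H0 H1).
    cbv beta in Hc; rewrite distance_ratio_dilation in Hc by assumption.
    assert (Hpos : 0 < distance_ratio unit_disk 0 (RtoC (1 / 2))).
    { unfold unit_disk; rewrite distance_ratio_open_disk; [| lra | assumption ..].
      apply (Rle_lt_trans _ (ln 1)); [rewrite ln_1; lra |].
      apply ln_increasing; [lra |].
      unfold Cminus; rewrite Cplus_0_l.
      rewrite Cmod_opp, Cmod_0, H2, Rmax_right by lra; lra. }
    apply (Rmult_le_reg_r _ _ _ Hpos); lra.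
Qed.
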